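(* Let $(I,\delta_1,\delta_2)$ be a regular P-configuration in $I=[-1,1]$. Then the functional equation $$f(t)=f(\delta_1(t))+f(\delta_2(t)),\qquad t\in I,$$ has a nonlinear continuous solution, i.e. there is a continuous function $f:I\to\mathbb{R}$ satisfying this equation which is not of the form $f(z)=cz$ $(z\in I)$ for any constant $c\in\mathbb{R}$.
   Context: Let $I=[-1,1]$. Two $C^1$ maps $\delta_1,\delta_2:I\to I$ form a P-configuration in $I$ if $\delta_1(t)+\delta_2(t)=t$ for all $t\in I$; $\delta_i'(t)\ge 0$ for all $t\in I$, $i=1,2$; and $\delta_2(-1)=-1$, $\delta_2(1)=\delta_1(-1)=0$, $\delta_1(1)=1$. The P-configuration is called regular if both guiding sets $\Lambda_i=\{t\in I:\delta_i'(t)=0\}$, $i=1,2$, are empty, i.e. $\delta_1'(t)>0$ and $\delta_2'(t)>0$ for all $t\in I$. *)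

(* Defs.v *)
From HB Require Import structures.
From mathcomp Require Import all_boot all_order all_algebra.
From mathcomp Require Import all_classical all_reals all_analysis.
Set Implicit Arguments.
Unset Strict Implicit.
Unset Printing Implicit Defensive.
Import Order.TTheory GRing.Theory Num.Theory.
Import numFieldNormedType.Exports.
Local Open Scope classical_set_scope.
Local Open Scope ring_scope.

(* A map defined on a set A is represented by a function on R of which only    *)
(* the values on A matter. Its derivative is therefore relative to A: on a     *)
(* closed interval it is the one-sided derivative at the endpoints.            *)
Definition diffq (R : realType) (f : R -> R) (x : R) : R -> R :=
  fun s => (f s - f x) / (s - x).

Definition derivable_within (R : realType) (A : set R) (f : R -> R) (x : R) :
  Prop := cvg (diffq f x @ within A x^').

Definition derive_within (R : realType) (A : set R) (f : R -> R) (x : R) : R :=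
  lim (diffq f x @ within A x^').

Definition C1_on (R : realType) (A : set R) (f : R -> R) : Prop :=
  (forall x, A x -> derivable_within A f x) /\
  {within A, continuous (derive_within A f)}.

Definition Iset (R : realType) : set R := `[-1, 1].
Arguments Iset R : clear implicits.

Record P_configuration (R : realType) (delta1 delta2 : R -> R) : Prop := {
  P_fun1 : set_fun (Iset R) (Iset R) delta1 ;
  P_fun2 : set_fun (Iset R) (Iset R) delta2 ;
  P_C1_1 : C1_on (Iset R) delta1 ;
  P_C1_2 : C1_on (Iset R) delta2 ;
  P_sum : forall t, Iset R t -> delta1 t + delta2 t = t ;
  P_deriv1_ge0 : forall t, Iset R t -> 0 <= derive_within (Iset R) delta1 t ;
  P_deriv2_ge0 : forall t, Iset R t -> 0 <= derive_within (Iset R) delta2 t ;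
  P_delta2_N1 : delta2 (-1) = -1 ;
  P_delta2_1 : delta2 1 = 0 ;
  P_delta1_N1 : delta1 (-1) = 0 ;
  P_delta1_1 : delta1 1 = 1 }.

Definition guiding_set (R : realType) (delta : R -> R) : set R :=
  [set t | Iset R t /\ derive_within (Iset R) delta t = 0].

Definition regular_P_configuration (R : realType) (delta1 delta2 : R -> R) :
  Prop :=
  [/\ P_configuration delta1 delta2, guiding_set delta1 = set0
    & guiding_set delta2 = set0].

(* Main.v *)
Require Import Defs.
From HB Require Import structures.
From mathcomp Require Import all_boot all_order all_algebra.
From mathcomp Require Import all_classical all_reals all_analysis.
From mathcomp Require Import lra.
Import Order.TTheory GRing.Theory Num.Theory.
Import numFieldNormedType.Exports.
Local Open Scope classical_set_scope.
Local Open Scope ring_scope.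

(** Write I for [-1, 1]. Both maps are strictly increasing, so delta1 has an
    inverse [0, 1] -> I and delta2 an inverse [-1, 0] -> I. These two inverses
    are the branches of one expanding map T on I, and since both of them send
    the common point 0 to an endpoint, T is a continuous self-map of degree 2
    of the circle obtained from I by identifying -1 and 1. The two preimages
    of t under T are delta1 t and delta2 t, hence the functional equation says
    that f is fixed by the transfer operator (L f) t = \sum_(T s = t) f s.

    Nonlinear fixed points of L can be built from the kernel of L. Since
    L (h \o T) = 2 h, if L phi = 0 then the series
      f = \sum_n 2^-n (phi \o T^n)
    satisfies f = phi + (f \o T) / 2 and L f = 0 + f. The choice made here is
    phi = T on [0, 1] and phi = - T on [-1, 0]: the two preimages of t
    contribute t and - t. This phi is continuous on the circle, hence so is
    every phi \o T^n (tent_iter_continuous), and the series converges uniformly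
    (within_continuous_series), so that f is continuous. For the affine maps
    delta1 t = (t + 1) / 2 and delta2 t = (t - 1) / 2, where T is the doubling
    map, f is Takagi's nowhere differentiable function up to affine changes of
    the variable and of the values.

    Finally -1 and 1 are fixed by T and phi is 1 at both, so f (-1) = f 1 = 2,
    which no linear function satisfies. *)

(** * Derivatives relative to a set *)

Lemma derivable_within_within_continuous (R : realType) (A : set R)
    (f : R -> R) :
  (forall x, A x -> derivable_within A f x) -> {within A, continuous f}.
Proof.
move=> df; apply/subspace_continuousP => x Ax.
have /cvg_ex[/= l /cvgrPdist_lt fl] := df x Ax.
apply/cvgrPdist_lt => e e0.
have l0 : 0 < `|l| + 1 by rewrite ltr_wpDl.
have nl : \forall s \near x, s != x -> A s -> `|l - diffq f x s| < 1.
  exact: fl 1 ltr01.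
suff : \forall s \near x, A s -> `|f x - f s| < e by [].
near=> s => As.
have [->|sx] := eqVneq s x; first by rewrite subrr normr0.
have q1 : `|l - diffq f x s| < 1 by move: sx As; near: s.
have qb : `|diffq f x s| < `|l| + 1.
  rewrite -[diffq f x s](subKr l) (le_lt_trans (ler_normB _ _))//.
  by rewrite ltrD2l.
have -> : f x - f s = - (diffq f x s * (s - x)).
  by rewrite /diffq divfK ?subr_eq0// opprB.
rewrite normrN normrM.
have : `|x - s| < e / (`|l| + 1) by near: s; apply: nbhsx_ballx; exact: divr_gt0.
rewrite ltr_pdivlMr// mulrC distrC; apply: le_lt_trans.
by rewrite ler_wpM2r// ltW.
Unshelve. all: by end_near. Qed.

(** Relative derivatives are ordinary ones in the interior, which is where the
    mean value theorem needs them. *)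
Lemma derivable_within_is_derive (R : realType) (A : set R) (f : R -> R)
    (x : R) :
  A^° x -> derivable_within A f x -> is_derive x 1 f (derive_within A f x).
Proof.
move=> /within_interior Ax df.
have Ax' : within A x^' = x^'.
  rewrite eqEsubset; split=> P; last by apply: filterS => s + _.
  rewrite /within /dnbhs /within /= => AP.
  suff : within A (nbhs x) (fun s => s != x -> P s) by rewrite Ax.
  have {}AP : \forall s \near x, s != x -> A s -> P s by [].
  by apply: filterS AP => s sP As sx; exact: sP.
rewrite /derive_within /derivable_within Ax' in df *.
have cf : h^-1 *: ((f \o shift x) (h *: 1) - f x) @[h --> 0^'] -->
    lim (diffq f x @ x^').
  apply/cvgrPdist_lt => e e0.
  have nl : \forall s \near x, s != x ->
      `|lim (diffq f x @ x^') - diffq f x s| < e.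
    by have /cvgrPdist_lt/(_ e e0) := df.
  move: nl; rewrite (near_shift 0) subr0.
  apply: filterS => h /= hP h0; rewrite /diffq /= in hP.
  move: hP; rewrite addrK -subr_eq0 addrK => /(_ h0).
  by rewrite /= /GRing.scale /= mulr1 [_ / h]mulrC.
by apply: DeriveDef; [apply/cvg_ex; eexists; exact: cf|exact/cvg_lim].
Qed.

Lemma derive_within_gt0_homo (R : realType) (a b : R) (f : R -> R) :
  (forall x, `[a, b]%classic x -> derivable_within `[a, b] f x) ->
  (forall x, `[a, b]%classic x -> 0 < derive_within `[a, b] f x) ->
  {in `[a, b]%R &, {homo f : x y / x < y}}.
Proof.
move=> df df0.
have der x : x \in `]a, b[%R -> is_derive x 1 f (derive_within `[a, b] f x).
  move=> xab; have xab' : `[a, b]%classic x by exact: subset_itv_oo_cc.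
  by apply: derivable_within_is_derive; [rewrite interior_itv|exact: df].
apply: gtr0_derive1_lt_cc; last exact: derivable_within_within_continuous.
- by move=> x /der /@ex_derive.
- move=> x xab; have xab' : `[a, b]%classic x by exact: subset_itv_oo_cc.
  by rewrite derive1E (@derive_val _ _ _ _ _ _ _ (der x xab)) df0.
Qed.

(** * Continuity relative to a set *)

(** The Weierstrass M-test: the tail of the series of M bounds the distance
    to the partial sums uniformly on K. *)
Lemma within_continuous_series (T : topologicalType) (R : realType) (K : set T)
    (u : nat -> T -> R) (M : nat -> R) :
  (forall n, {within K, continuous (u n)}) ->
  (forall n x, K x -> `|u n x| <= M n) -> cvgn (series M) ->
  {within K, continuous (fun x => limn (series (u ^~ x)))}.
Proof.
move=> cu uM cM.
have cux x : K x -> cvgn [normed series (u ^~ x)].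
  move=> Kx; apply: (series_le_cvg _ _ _ cM) => n /=; rewrite ?normr_ge0 ?uM//.
  exact: le_trans (uM n x Kx).
have cS n : {within K, continuous (fun x => series (u ^~ x) n)}.
  elim: n => [|n IH].
    have -> : (fun x => series (u ^~ x) 0) = (fun=> 0).
      by apply/funext => x; rewrite /series /= big_geq.
    by apply: continuous_subspaceT => x; exact: cst_continuous.
  have -> : (fun x => series (u ^~ x) n.+1) = (fun x => series (u ^~ x) n) + u n.
    by apply/funext => x; rewrite seriesSr.
  exact: within_continuousD.
have tail x n : K x ->
    `|limn (series (u ^~ x)) - series (u ^~ x) n| <= limn (series M) - series M n.
  move=> Kx; have cs := normed_cvg (cux x Kx).
  have cu_tail : `|series (u ^~ x) m - series (u ^~ x) n| @[m --> \oo] -->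
      `|limn (series (u ^~ x)) - series (u ^~ x) n|.
    by apply: cvg_norm; apply: cvgB; [exact: cs|exact: cvg_cst].
  have cM_tail : series M m - series M n @[m --> \oo] -->
      limn (series M) - series M n.
    by apply: cvgB; [exact: cM|exact: cvg_cst].
  apply: ler_cvg_to cu_tail cM_tail _.
  near=> m; have nm : (n <= m)%N by near: m; exact: nbhs_infty_ge.
  rewrite !sub_series_geq// (le_trans (ler_norm_sum _ _ _))//.
  by apply: ler_sum => k _; exact: uM.
apply: (@uniform_limit_continuous_subspace _ _ K
  ((fun n x => series (u ^~ x) n) @ \oo)).
  suff : \forall n \near \oo,
    {within K, continuous (fun x => series (u ^~ x) n)} by [].
  exact: nearW.
move=> P /uniform_nbhs[E [entE EP]].
have [e /= e0 eE] : exists2 e, 0 < e & [set xy | ball xy.1 e xy.2] `<=` E.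
  by move: entE; rewrite -entourage_ballE => -[e e0 eE]; exists e.
have nM : \forall n \near \oo, `|limn (series M) - series M n| < e.
  by move: e e0 {eE}; apply/cvgrPdist_lt.
apply: filterS nM => n nM; apply: EP => x Kx; apply: eE.
by rewrite /ball /= (le_lt_trans (tail x n Kx))// (le_lt_trans (ler_norm _)).
Unshelve. all: by end_near. Qed.

Lemma within_continuous_comp_sub (S T U : topologicalType) (A : set S)
    (B : set T) (f : S -> T) (g : T -> U) :
  set_fun A B f -> {within A, continuous f} -> {within B, continuous g} ->
  {within A, continuous (g \o f)}.
Proof.
move=> fAB /subspace_continuousP cf /subspace_continuousP cg.
apply/subspace_continuousP => x Ax; apply: cvg_trans (cg _ (fAB _ Ax)) => P.
move=> /(cf x Ax) Pf.
have {}Pf : \forall s \near x, A s -> B (f s) -> P (g (f s)) by [].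
suff : \forall s \near x, A s -> P (g (f s)) by [].
by apply: filterS Pf => s sP As; apply: (sP As); exact: fAB.
Qed.

Lemma within_continuous_if (R : realType) (a c b : R) (u v : R -> R) :
  a <= c <= b -> {within `[c, b], continuous u} ->
  {within `[a, c], continuous v} -> u c = v c ->
  {within `[a, b], continuous (fun s => if c <= s then u s else v s)}.
Proof.
move=> /andP[ac cb] cu cv uv.
have -> : `[a, b]%classic = `[a, c] `|` `[c, b].
  apply/seteqP; split=> x /=; rewrite !in_itv /=.
    move=> /andP[ax xb]; have [cx|xc] := leP c x; [right|left].
      by rewrite xb.
    by rewrite ax ltW.
  by case=> /andP[h1 h2]; rewrite ?h1 ?h2 ?andbT /=;
    [exact: le_trans h2 cb|exact: le_trans ac h1].
apply: withinU_continuous; [exact: itv_closed|exact: itv_closed| |].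
- apply: (subspace_eq_continuous _ cv) => x /set_mem /=.
  rewrite in_itv /from_subspace/=.
  move=> /andP[_ xc]; case: ifP => // cx.
  by have -> : x = c by apply/le_anti; rewrite xc cx.
- apply: (subspace_eq_continuous _ cu) => x /set_mem /=.
  rewrite in_itv /from_subspace/=.
  by move=> /andP[-> _].
Qed.

Lemma segment_inverse (R : realType) (a b : R) (f : R -> R) : a <= b ->
  {within `[a, b], continuous f} -> {in `[a, b]%R &, injective f} ->
  exists g : R -> R, [/\ {in `[a, b]%R, cancel f g},
    set_fun `[f a, f b] `[a, b] g & {within `[f a, f b], continuous g}].
Proof.
move=> ab cf fI.
have fK : {in `[a, b]%R, cancel f (pinv `[a, b] f)}.
  move=> x xab; apply: pinvKV; last by rewrite inE.
  by move=> y z /[!inE] yab zab; exact: fI.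
exists (pinv `[a, b] f); split=> //; last exact: segment_can_le_continuous.
move=> y /= yab; have fab : f a <= f b by rewrite (itvP yab).
by have /(_ y yab)[x xab <-] := segment_continuous_le_surjective ab fab cf;
  rewrite fK.
Qed.

(** * The fixed function of a degree 2 circle map *)

(** The circle is I with -1 and 1 identified; g1 and g2 are the two branches of
    the map. The four endpoint values make it well defined at 0 and at the
    identified endpoints. *)
Section two_branches.
Context {R : realType}.
Variables g1 g2 : R -> R.
Let I : set R := `[-1, 1].
Let I1 : set R := `[0, 1].
Let I2 : set R := `[-1, 0].
Hypothesis g1I : set_fun I1 I g1.
Hypothesis g2I : set_fun I2 I g2.
Hypothesis g1C : {within I1, continuous g1}.
Hypothesis g2C : {within I2, continuous g2}.
Hypothesis g10 : g1 0 = -1.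
Hypothesis g11 : g1 1 = 1.
Hypothesis g2N1 : g2 (-1) = -1.
Hypothesis g20 : g2 0 = 1.

Definition doubling (s : R) := if 0 <= s then g1 s else g2 s.
(** The opposite signs put it in the kernel of the transfer operator: the two
    preimages of t contribute t and - t. *)
Definition tent (s : R) := if 0 <= s then g1 s else - g2 s.
Definition term (n : nat) (s : R) := 2^-1 ^+ n * tent (iter n doubling s).
Definition takagi (s : R) := limn (series (term ^~ s)).

Let ltN10 : (0 <= -1 :> R) = false. Proof. by rewrite oppr_ge0 ler10. Qed.

(** A function on the circle composed with the degree 2 map: the values of u
    at -1 and of v at 1 meet at the junction point 0. *)
Lemma branches_continuous (u v : R -> R) :
  {within I, continuous u} -> {within I, continuous v} -> u (-1) = v 1 ->
  {within I, continuous (fun s => if 0 <= s then u (g1 s) else v (g2 s))}.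
Proof.
move=> cu cv uv; apply: within_continuous_if.
- by rewrite lerN10 ler01.
- exact: within_continuous_comp_sub g1I g1C cu.
- exact: within_continuous_comp_sub g2I g2C cv.
- by rewrite g10 g20.
Qed.

Lemma itv_split_sign s : I s -> if 0 <= s then I1 s else I2 s.
Proof.
rewrite /I /I1 /I2 /= !in_itv /= => /andP[s1 s2].
by case: leP => s0; rewrite ?s2 // s1 ltW.
Qed.

Lemma doublingI : set_fun I I doubling.
Proof.
move=> s /itv_split_sign; rewrite /doubling.
by case: ifP => _; [exact: g1I|exact: g2I].
Qed.

Lemma iter_doublingI n : set_fun I I (iter n doubling).
Proof. by elim: n => //= n IH s /IH; exact: doublingI. Qed.

Lemma tent_bound s : I s -> `|tent s| <= 1.
Proof.
move=> /itv_split_sign; rewrite /tent; case: ifP => _.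
  by move=> /g1I; rewrite /I /= in_itv /= ler_norml.
by move=> /g2I; rewrite /I /= in_itv /= normrN ler_norml.
Qed.

Lemma doubling1 : doubling 1 = 1. Proof. by rewrite /doubling ler01. Qed.
Lemma doublingN1 : doubling (-1) = -1. Proof. by rewrite /doubling ltN10. Qed.
Lemma tent1 : tent 1 = 1. Proof. by rewrite /tent ler01. Qed.
Lemma tentN1 : tent (-1) = 1. Proof. by rewrite /tent ltN10 g2N1 opprK. Qed.

Lemma tent_iter_continuous n :
  {within I, continuous (tent \o iter n doubling)}.
Proof.
have cid : {within I, continuous (@id R)} by apply: continuous_subspaceT => x.
have fix1 m : iter m doubling 1 = 1 by elim: m => //= m ->; exact: doubling1.
have fixN1 m : iter m doubling (-1) = -1 by elim: m => //= m ->; exact: doublingN1.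
elim: n => [|n IH].
  apply: (branches_continuous id -%R cid) => //.
  by apply: continuous_subspaceT => x; exact: opp_continuous.
rewrite (_ : _ \o _ = fun s => if 0 <= s then (tent \o iter n doubling) (g1 s)
    else (tent \o iter n doubling) (g2 s)).
  by apply: branches_continuous => //=; rewrite fix1 fixN1 tent1 tentN1.
by apply/funext => s; rewrite -fun_if /= -iterS iterSr.
Qed.

Let half_lt1 : `|2^-1 : R| < 1.
Proof. by rewrite ger0_norm ?invr_ge0// invf_lt1// ltr1n. Qed.

Lemma term_bound n s : I s -> `|term n s| <= geometric 1 2^-1 n.
Proof.
move=> Is; rewrite /term /= mul1r normrM ger0_norm ?exprn_ge0 ?invr_ge0//.
by rewrite ler_piMr ?exprn_ge0 ?invr_ge0// tent_bound//; exact: iter_doublingI.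
Qed.

Lemma takagi_continuous : {within I, continuous takagi}.
Proof.
apply: (within_continuous_series _ _ _ _ (geometric 1 2^-1)).
- move=> n; apply: (@within_continuous_comp _ _ _ _ (tent \o iter n doubling)).
    by move=> x _; exact: mulrl_continuous.
  exact: tent_iter_continuous.
- by move=> n x; exact: term_bound.
- exact: is_cvg_geometric_series.
Qed.

Lemma takagiE s : I s -> takagi s = tent s + 2^-1 * takagi (doubling s).
Proof.
have cvgt t : I t -> series (term ^~ t) @ \oo --> takagi t.
  move=> It; apply: normed_cvg.
  apply: (series_le_cvg _ _ _ (@is_cvg_geometric_series R 1 _ half_lt1)).
  - by move=> n; exact: normr_ge0.
  - by move=> n; exact: (le_trans (normr_ge0 _) (term_bound n t It)).
  - by move=> n; exact: term_bound.
move=> Is; apply/cvg_lim => //; rewrite -cvg_shiftS.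
rewrite (_ : [sequence _]_n =
    (fun n => tent s + 2^-1 * series (term ^~ (doubling s)) n)).
  apply: cvgD; first exact: cvg_cst.
  by apply: cvgMr; apply: cvgt; exact: doublingI.
apply/funext => n; rewrite /series /= big_nat_recl//; congr (_ + _).
  by rewrite /term expr0 mul1r.
rewrite mulr_sumr; apply: eq_bigr => k _.
by rewrite /term exprS mulrA iterSr.
Qed.

Lemma takagi_fixed s : I s -> doubling s = s -> takagi s = 2 * tent s.
Proof. by move=> Is ds; have := takagiE s Is; rewrite ds; lra. Qed.

Lemma takagi1 : takagi 1 = 2.
Proof.
rewrite takagi_fixed ?doubling1 ?tent1 ?mulr1//.
by rewrite /I /= in_itv /= lexx ge0_cp.
Qed.

Lemma takagiN1 : takagi (-1) = 2.
Proof.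
rewrite takagi_fixed ?doublingN1 ?tentN1 ?mulr1//.
by rewrite /I /= in_itv /= lexx ge0_cp.
Qed.

Lemma takagi_right y : I1 y -> takagi y = g1 y + 2^-1 * takagi (g1 y).
Proof.
rewrite /I1 /= in_itv /= => /andP[y0 y1].
rewrite takagiE /tent /doubling ?y0//.
by rewrite /I /= in_itv /= y1 andbT (le_trans _ y0)// lerN10.
Qed.

Lemma takagi_left y : I2 y -> takagi y = - g2 y + 2^-1 * takagi (g2 y).
Proof.
rewrite /I2 /= in_itv /= => /andP[yN1].
rewrite le_eqVlt => /predU1P[->|y0].
  (* At 0 the map is defined by g1, which gives the value -1 instead of 1. *)
  rewrite takagi_right ?g10 ?g20 ?takagi1 ?takagiN1//.
  by rewrite /I1 /= in_itv /= lexx ler01.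
rewrite takagiE /tent /doubling; first by rewrite leNgt y0.
by rewrite /I /= in_itv /= yN1 (le_trans (ltW y0) ler01).
Qed.

End two_branches.

(** * The functional equation *)

(** The inverses of d1 and d2 serve as branches. On them the fixed function is
    given by f (d1 t) = t + f t / 2 and f (d2 t) = - t + f t / 2, whose sum is
    the functional equation. *)
Lemma nonlinear_solution (R : realType) (d1 d2 : R -> R) :
  {within `[-1, 1], continuous d1} -> {within `[-1, 1], continuous d2} ->
  {in `[-1, 1]%R &, injective d1} -> {in `[-1, 1]%R &, injective d2} ->
  d1 (-1) = 0 -> d1 1 = 1 -> d2 (-1) = -1 -> d2 1 = 0 ->
  exists f : R -> R,
    [/\ {within `[-1, 1], continuous f},
        {in `[-1, 1]%R, forall t, f t = f (d1 t) + f (d2 t)}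
      & f (-1) = f 1 /\ f 1 != 0].
Proof.
move=> c1 c2 inj1 inj2 d1N1 d11 d2N1 d21.
have N11 : -1 <= 1 :> R by rewrite ge0_cp.
have IN1 : -1 \in `[-1, 1 : R] by rewrite in_itv /= lexx.
have I1 : 1 \in `[-1, 1 : R] by rewrite in_itv /= lexx andbT.
have [g1 [g1K]] := segment_inverse _ _ _ _ N11 c1 inj1.
have [g2 [g2K]] := segment_inverse _ _ _ _ N11 c2 inj2.
rewrite d1N1 d11 d2N1 d21 => g2I g2C g1I g1C.
have g10 : g1 0 = -1 by rewrite -d1N1 g1K.
have g11 : g1 1 = 1 by rewrite -[in LHS]d11 g1K.
have g2N1 : g2 (-1) = -1 by rewrite -[in LHS]d2N1 g2K.
have g20 : g2 0 = 1 by rewrite -d21 g2K.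
exists (takagi g1 g2); split.
- exact: takagi_continuous.
- move=> t It.
  have mono1 := segment_continuous_inj_le _ c1 inj1.
  have mono2 := segment_continuous_inj_le _ c2 inj2.
  rewrite d1N1 d11 in mono1; rewrite d2N1 d21 in mono2.
  have h1 : `[0, 1]%classic (d1 t).
    rewrite /= in_itv /= -[X in X <= _ <= _]d1N1 -[X in _ <= _ <= X]d11.
    by rewrite !mono1 ?ler01.
  have h2 : `[-1, 0]%classic (d2 t).
    rewrite /= in_itv /= -[X in X <= _ <= _]d2N1 -[X in _ <= _ <= X]d21.
    by rewrite !mono2 ?lerN10.
  rewrite [takagi g1 g2 (d1 t)]takagi_right //
    [takagi g1 g2 (d2 t)]takagi_left //.
  rewrite g1K // g2K //.
  by lra.
- by rewrite takagi1 // takagiN1.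
Qed.

Theorem theorem3p1 (R : realType) (delta1 delta2 : R -> R)
    (hdelta : regular_P_configuration delta1 delta2) :
  exists f : R -> R,
    [/\ {within Iset R, continuous f},
        forall t, Iset R t -> f t = f (delta1 t) + f (delta2 t)
      & ~ exists c : R, forall z, Iset R z -> f z = c * z].
Proof.
case: hdelta => -[_ _ [der1 _] [der2 _] _ ge1 ge2 d2N1 d21 d1N1 d11] reg1 reg2.
have inj (d : R -> R) :
    (forall x, Iset R x -> derivable_within (Iset R) d x) ->
    (forall t, Iset R t -> 0 <= derive_within (Iset R) d t) ->
    guiding_set d = set0 -> {in `[-1, 1]%R &, injective d}.
  move=> der ge0 reg.
  have hd : {in `[-1, 1]%R &, {homo d : x y / x < y}}.
    apply: derive_within_gt0_homo => // x Ix; rewrite lt_neqAle ge0// andbT.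
    apply/eqP => dx0.
    have : guiding_set d x by split.
    by rewrite reg.
  move=> x y Ix Iy dxy; apply/eqP; case: ltgtP => // xy.
    by have := hd x y Ix Iy xy; rewrite dxy ltxx.
  by have := hd y x Iy Ix xy; rewrite dxy ltxx.
have [||||f [fC fE [fN1 f1]]] := @nonlinear_solution R delta1 delta2
  _ _ _ _ d1N1 d11 d2N1 d21.
- exact: derivable_within_within_continuous.
- exact: derivable_within_within_continuous.
- exact: inj.
- exact: inj.
exists f; split=> // -[c fc].
have N11 : -1 <= 1 :> R by rewrite ge0_cp.
have := fc 1; have := fc (-1); rewrite /Iset /= !in_itv /= !lexx N11.
move=> /(_ isT) hN /(_ isT) h1.
by move/eqP: f1; apply; move: fN1 hN h1; lra.
Qed.
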